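(* For every fixed $n \in \mathbb{N}$, $n \ge 1$, there is a constant $c_n > 0$ depending only on $n$ such that the following holds. Let $f : \mathbb{R}^n \to \mathbb{R}$ be a spline over the hyperplane partition of $\mathbb{R}^n$ induced by $b \ge 1$ degree-one polynomials $\pi_1,\dots,\pi_b \in \mathbb{R}[x_1,\dots,x_n]$. Let $\Pi_1,\dots,\Pi_m$ be the chambers of this partition, let $g_i \in \mathbb{R}[x_1,\dots,x_n]$ be the polynomial that $f$ coincides with on $\Pi_i$, $i = 1,\dots,m$, and let $d = \max\{\deg g_i : i = 1,\dots,m\}$. Then $f$ is max-definable; more precisely, there are a positive integer $p$ and polynomials $f_{ij} \in \mathbb{R}[x_1,\dots,x_n]$, $i,j = 1,\dots,p$, with \[ f = \max_{i=1,\dots,p}\ \min_{j=1,\dots,p} f_{ij}, \] with $\deg f_{ij} \le 2d+1$ for all $i,j$, and with $p = O(b^{2n^2} d^n)$, that is, $p \le c_n\, b^{2n^2} d^n$ whenever $d \ge 1$.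
   Context: Hyperplane partition: let $\Theta_b$ be the set of all maps $\theta : \{1,\dots,b\} \to \{1,0,-1\}$. Given degree-one polynomials $\pi_1,\dots,\pi_b \in \mathbb{R}[x_1,\dots,x_n]$, put $\Pi_\theta := \{x \in \mathbb{R}^n : \operatorname{sgn}(\pi_i(x)) = \theta(i),\ i = 1,\dots,b\}$ for $\theta \in \Theta_b$, where $\operatorname{sgn}$ takes values in $\{1,0,-1\}$. The collection $\{\Pi_\theta : \theta \in \Theta_b\}$ is the hyperplane partition induced by $\pi_1,\dots,\pi_b$; each $\Pi_\theta$ is a piece, and a piece of full dimension $n$ is called a chamber. Spline: a continuous function $f : \mathbb{R}^n \to \mathbb{R}$ is a spline over this hyperplane partition if on every nonempty piece $\Pi_\theta$ it coincides with some polynomial in $\mathbb{R}[x_1,\dots,x_n]$. Max-definable: a function $\mathbb{R}^n \to \mathbb{R}$ is max-definable if it belongs to the smallest set of functions $\mathbb{R}^n \to \mathbb{R}$ that contains the coordinate functions $x_1,\dots,x_n$ and the real constants and is closed under the pointwise operations of addition, multiplication, maximum, and multiplication by real scalars. Convention: the zero polynomial is assigned degree $0$. *)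

(* Defs.v *)
From HB Require Import structures.
From mathcomp Require Import all_boot all_order all_algebra.
From mathcomp Require Import all_classical all_reals all_analysis.
(* The notations of mpoly clash with those of analysis. *)
From mathcomp Require Import -(notations) mpoly.

Set Implicit Arguments.
Unset Strict Implicit.
Unset Printing Implicit Defensive.

Import Order.TTheory GRing.Theory Num.Theory numFieldNormedType.Exports.

Local Open Scope classical_set_scope.
Local Open Scope ring_scope.

Section Polynomials.
Variables (R : realType) (n : nat).

Definition peval (q : mpoly n R) (x : 'rV[R]_n) : R := meval (fun i => x ord0 i) q.

(* [msize] is 1 + total degree, and 0 for the zero polynomial; hence
   [deg 0 = 0]. *)
Definition deg (q : mpoly n R) : nat := (msize q).-1.

End Polynomials.

Section Dimension.
Variables (R : realType) (n : nat).

Definition affinely_independent k (u : 'I_k.+1 -> 'rV[R]_n) : bool :=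
  row_free (\matrix_(i < k) (u (lift ord0 i) - u ord0)).

(* [has_dim A k]: the affine hull of [A] has dimension [k]. The empty set has
   no dimension. *)
Definition has_dim (A : set 'rV[R]_n) (k : nat) : Prop :=
  (exists u : 'I_k.+1 -> 'rV[R]_n,
      (forall i, A (u i)) /\ affinely_independent u) /\
  (forall l (u : 'I_l.+1 -> 'rV[R]_n),
      (forall i, A (u i)) -> affinely_independent u -> (l <= k)%N).

End Dimension.

Section HyperplanePartition.
Variables (R : realType) (n b : nat).

Definition sign3 := seq_sub [:: 1 : int; 0; -1].

Definition Theta := {ffun 'I_b -> sign3}.

Definition piece (pi : 'I_b -> mpoly n R) (theta : Theta) : set 'rV[R]_n :=
  [set x | forall i, sgz (peval (pi i) x) = ssval (theta i)].

Definition chamber (pi : 'I_b -> mpoly n R) (theta : Theta) : Prop :=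
  has_dim (piece pi theta) n.

Definition coincide_on (A : set 'rV[R]_n) (f : 'rV[R]_n -> R)
    (q : mpoly n R) : Prop :=
  forall x, A x -> f x = peval q x.

Definition spline (pi : 'I_b -> mpoly n R) (f : 'rV[R]_n -> R) : Prop :=
  continuous f /\
  forall theta, piece pi theta !=set0 ->
    exists q, coincide_on (piece pi theta) f q.

(* Distinct sign maps have disjoint pieces, so a family indexed by the chambers
   is a family indexed by their sign maps; values of [g] at the other sign maps
   are ignored. *)
Definition max_deg_on_chambers (pi : 'I_b -> mpoly n R)
    (g : Theta -> mpoly n R) : nat :=
  (\max_(theta : Theta | `[< chamber pi theta >]) deg (g theta))%N.

End HyperplanePartition.

Inductive max_definable (R : realType) (n : nat) : ('rV[R]_n -> R) -> Prop :=
| MaxDefCoord (i : 'I_n) : max_definable (fun x => x ord0 i)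
| MaxDefConst (a : R) : max_definable (fun=> a)
| MaxDefAdd f g : max_definable f -> max_definable g ->
    max_definable (fun x => f x + g x)
| MaxDefMul f g : max_definable f -> max_definable g ->
    max_definable (fun x => f x * g x)
| MaxDefMax f g : max_definable f -> max_definable g ->
    max_definable (fun x => Num.max (f x) (g x))
| MaxDefScale (a : R) f : max_definable f ->
    max_definable (fun x => a * f x).

(* Starting the iteration at the first term avoids a bottom or top element,
   which [R] does not have. *)
Definition fin_max (R : realType) (p : nat) (u : 'I_p.+1 -> R) : R :=
  \big[Num.max/u ord0]_(i < p.+1) u i.

Definition fin_min (R : realType) (p : nat) (u : 'I_p.+1 -> R) : R :=
  \big[Num.min/u ord0]_(i < p.+1) u i.

(* Main.v *)
Require Import Defs.
From HB Require Import structures.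
From mathcomp Require Import all_boot all_order all_algebra.
From mathcomp Require Import all_classical all_reals all_analysis.
From mathcomp Require Import -(notations) mpoly.
From mathcomp Require Import ring lra.

(** For a set A of indices let the cell of A be the set where pi_j is positive
    for j in A and negative for the other j. The nonempty cells are chambers,
    and their union is dense. For two nonempty cells A and B, with f equal to
    gA on the first and to gB on the second, suppose that h_AB is a polynomial
    with h_AB <= f on A and f <= h_AB on B ([separating_poly]). Then, for each
    B, the minimum over A of the h_AB is at most f on every cell, and on the
    cell B it is at least f. So f is the maximum over B of these minima on a
    dense set, hence everywhere, both sides being continuous.

    To find h_AB, let l be the sum of the pi_j for which A and B lie on
    opposite sides of the hyperplane pi_j = 0, each with the sign that it has
    on B, and let N = 1 + x_1^2 + ... + x_n^2. Then l is positive on B and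
    negative on A when A and B differ, and
      h_AB = gB + kappa * l * N^d
    has degree at most 2 d + 1 and lies above gB on B. It lies below gA on A
    as soon as |gA - gB| <= kappa * |l| * N^d there. This estimate is where
    continuity enters. The common points of the closures of A and B are the
    solutions of the affine inequalities that define both of them, and a
    point x of A violates these by at most |l(x)|. By Hoffman's error bound
    ([hoffman]), either such a system has no solution and its violation is
    bounded away from 0, so that the growth of gA - gB is the only concern, or
    there is a solution y at distance at most C |l(x)| from x. In the second
    case gA(y) = f(y) = gB(y), so (gA - gB)(x) is the difference of the values
    of one polynomial at x and y, which is at most a constant times
    |x - y| * N(x)^d ([peval_lip]). Hoffman's bound itself is proved by
    Fourier-Motzkin elimination.

    For the number p of nonempty cells: the cells, as sets of indices, shatter
    no set of more than n indices, because the linear parts of n + 1 affine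
    functions are linearly dependent ([shattered_card]). By the Sauer-Shelah
    lemma p is at most the sum of the binomials of b over i for i <= n, hence
    at most (n + 1) b^n <= (n + 1) b^(2 n^2) d^n when b and d are positive. *)

Set Implicit Arguments.
Unset Strict Implicit.
Unset Printing Implicit Defensive.

Import Order.TTheory GRing.Theory Num.Theory numFieldNormedType.Exports.

Local Open Scope classical_set_scope.
Local Open Scope ring_scope.

(** * The Sauer-Shelah lemma *)

Section SauerShelah.
Variable T : finType.
Implicit Types (S : {set {set T}}) (A B D J : {set T}).

Definition shatters S J : Prop :=
  forall B, B \subset J -> exists2 A, A \in S & A :&: J = B.

(** Induction on D. Removing a point a of D maps S onto a family of subsets of
    the rest of D, and the sets with two preimages form a second family; the
    two cardinals add up to the cardinal of S. The first family shatters only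
    sets that S shatters. If the second one shatters J then S shatters a |: J,
    so k drops by one, and the bounds add up by Pascal's rule. *)
Lemma sauer_shelah k D S : (forall A, A \in S -> A \subset D) ->
  (forall J, shatters S J -> (#|J| < k)%N) ->
  (#|S| <= \sum_(i < k) 'C(#|D|, i))%N.
Proof.
move: {2}#|D| (erefl #|D|) => m; elim: m k D S => [|m IH] k D S cD SD Sk.
  case: (set_0Vmem S) => [->|[A AS]]; first by rewrite finset.cards0.
  have SE B : B \in S -> B = finset.set0.
    by move=> /SD; rewrite (finset.cards0_eq cD) finset.subset0 => /eqP.
  have /Sk : shatters S finset.set0.
    move=> B; rewrite finset.subset0 => /eqP ->.
    by exists A => //; rewrite (SE _ AS) finset.setI0.
  rewrite finset.cards0; case: k {Sk} => // k _.
  rewrite big_ord_recl bin0 (leq_trans _ (leq_addr _ _)) //.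
  rewrite -(finset.cards1 (finset.set0 : {set T})) subset_leq_card //.
  by apply/fintype.subsetP => B /SE ->; rewrite inE.
have [a aD] : exists a, a \in D by apply/card_gt0P; rewrite cD.
pose S0 : {set {set T}} := [set A in S | a \notin A]%SET.
pose S1 : {set {set T}} := [set A :\ a | A in [set A in S | a \in A]]%SET.
have cS : #|S| = (#|S0 :|: S1| + #|S0 :&: S1|)%N.
  rewrite finset.cardsUI card_in_imset => [|A B].
    rewrite addnC -(cardID [pred A : {set T} | a \in A] (mem S)).
    by congr (_ + _)%N; apply: eq_card => A; rewrite !inE andbC.
  rewrite !inE => /andP[_ aA] /andP[_ aB] /(congr1 (fun X => a |: X)).
  by rewrite !finset.setD1K.
case: k Sk => [|k] Sk.
  rewrite big_ord0 leqn0 cards_eq0; apply/eqP/finset.setP => A; rewrite inE.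
  apply/negP => AS; suff /Sk : shatters S finset.set0 by [].
  move=> B; rewrite finset.subset0 => /eqP ->.
  by exists A => //; rewrite finset.setI0.
have cDa : #|D :\ a| = m by move: cD; rewrite (cardsD1 a) aD => -[].
have S0D A : A \in S0 -> A \subset D :\ a.
  by rewrite inE => /andP[/SD AD aA]; rewrite finset.subsetD1 AD.
have S1D A : A \in S1 -> A \subset D :\ a.
  by move=> /imsetP[B]; rewrite inE => /andP[/SD BD _] ->; rewrite finset.setSD.
(* The union below is the image of S under A |-> A :\ a. *)
have S01 : forall A, A \in S0 :|: S1 -> a \notin A /\
    exists2 B, B \in S & A = B :\ a.
  move=> A; rewrite inE => /orP[|/imsetP[B]]; rewrite inE => /andP[AS aA].
    split=> //; exists A => //; apply/finset.setP => x; rewrite !inE.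
    by case: eqVneq => // ->; apply/negbTE.
  by move=> ->; rewrite !inE eqxx; split=> //; exists B.
have bound1 : (#|S0 :|: S1| <= \sum_(i < k.+1) 'C(m, i))%N.
  rewrite -cDa; apply: IH => // [A|J hJ].
    by rewrite inE => /orP[/S0D|/S1D].
  have aJ : a \notin J.
    have [A /S01[aA _] /finset.setIidPr JA] := hJ J (subxx _).
    by apply: contra aA => /(fintype.subsetP JA).
  apply: Sk => B BJ; have [A /S01[_ [C CS ->]] <-] := hJ B BJ.
  exists C => //; apply/finset.setP => x; rewrite !inE.
  by case: eqVneq => // ->; rewrite (negbTE aJ) andbF.
have bound2 : (#|S0 :&: S1| <= \sum_(i < k) 'C(m, i))%N.
  rewrite -cDa; apply: IH => // [A|J hJ].
    by rewrite inE => /andP[/S0D].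
  have aJ : a \notin J.
    have [A + /finset.setIidPr JA] := hJ J (subxx _).
    rewrite !inE => /andP[/andP[_ aA] _].
    by apply: contra aA => /(fintype.subsetP JA).
  suff /Sk : shatters S (a |: J) by rewrite cardsU1 aJ.
  move=> B BJ; have [|A + AB] := hJ (B :\ a).
    by rewrite finset.subDset.
  rewrite !inE => /andP[/andP[AS aA] /imsetP[C]].
  rewrite inE => /andP[CS aC] AC.
  have hx x : x != a -> (x \in B) = (x \in A) && (x \in J).
    by move=> xa; move/finset.setP: AB => /(_ x); rewrite !inE xa.
  have CA x : x != a -> (x \in A) = (x \in C) by rewrite AC !inE => ->.
  case: (boolP (a \in B)) => aB; [exists C | exists A] => //;
    apply/finset.setP => x; rewrite !inE; case: (eqVneq x a) => [->|xa] //=.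
  - by rewrite aC aB.
  - by rewrite hx // CA.
  - by rewrite (negbTE aA) (negbTE aB).
  - by rewrite hx.
rewrite cS cD (leq_trans (leq_add bound1 bound2)) //.
rewrite big_ord_recl [leqRHS]big_ord_recl !bin0 -addnA leq_add2l -big_split /=.
by apply: leq_sum => i _; rewrite /bump /= !add1n binS.
Qed.

End SauerShelah.

Lemma sum_bin_le m n : (0 < m)%N ->
  (\sum_(i < n.+1) 'C(m, i) <= n.+1 * m ^ n)%N.
Proof.
move=> m0; rewrite -[X in (_ <= X * _)%N]card_ord -sum_nat_const.
apply: leq_sum => i _; apply: leq_trans (leq_pexp2l m0 (leq_ord i)).
have := bin_ffact m i; have ffle : (m ^_ i <= m ^ i)%N.
  have -> : (m ^ i = \prod_(j < i) m)%N by rewrite prod_nat_const card_ord.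
  by rewrite ffact_prod; apply: leq_prod => j _; rewrite leq_subr.
by move=> E; apply: leq_trans ffle; rewrite -E leq_pmulr // fact_gt0.
Qed.

(** * Hoffman's error bound *)

Section Hoffman.
Variables (R : realType) (n : nat).
Implicit Types (p q : 'rV[R]_n * R) (x y : 'rV[R]_n) (S : seq ('rV[R]_n * R)).

(** The pair p = (a, c) encodes the affine function x |-> c + a . x. *)
Definition aval p x : R := p.2 + \sum_i p.1 0 i * x 0 i.

Definition upd x (k : 'I_n) (s : R) : 'rV[R]_n :=
  \row_i (if i == k then s else x 0 i).

Lemma aval_upd p x k s : aval p (upd x k s) = aval p x + p.1 0 k * (s - x 0 k).
Proof.
rewrite /aval -addrA; congr (_ + _); rewrite (bigD1 k) //= [in RHS](bigD1 k) //=.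
rewrite mxE eqxx (eq_bigr (fun i => p.1 0 i * x 0 i)); first ring.
by move=> i /negbTE ik; rewrite mxE ik.
Qed.

Lemma aval_lip p x y (e : R) : (forall i, `|x 0 i - y 0 i| <= e) ->
  `|aval p x - aval p y| <= (\sum_i `|p.1 0 i|) * e.
Proof.
move=> xy; rewrite /aval opprD addrACA subrr add0r -sumrB mulr_suml.
apply: le_trans (ler_norm_sum _ _ _) _; apply: ler_sum => i _.
by rewrite -mulrBr normrM ler_wpM2l.
Qed.

(** Meant for a positive k-th coefficient in p and a negative one in q: both
    forms are divided by the absolute value of that coefficient and added, so
    that the k-th variable disappears. *)
Definition fm_elim (k : 'I_n) p q : 'rV[R]_n * R :=
  ((p.1 0 k)^-1 *: p.1 - (q.1 0 k)^-1 *: q.1,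
   (p.1 0 k)^-1 * p.2 - (q.1 0 k)^-1 * q.2).

Lemma aval_fm k p q x : aval (fm_elim k p q) x =
  (p.1 0 k)^-1 * aval p x - (q.1 0 k)^-1 * aval q x.
Proof.
rewrite /aval /= !mulrDr opprD addrACA !mulr_sumr -sumrB; congr (_ + _).
by apply: eq_bigr => i _; rewrite !mxE mulrBl !mulrA.
Qed.

Lemma separating_point (Lo Up : seq R) (l0 : R) : l0 \in Lo ->
  {in Lo & Up, forall l u, l <= u} ->
  exists t, {in Lo, forall l, l <= t} /\ {in Up, forall u, t <= u}.
Proof.
move=> l0Lo LU; exists (\big[Num.max/l0]_(l <- Lo) l); split=> [l lLo|u uUp].
  exact: (@le_bigmax_seq _ _ _ Lo l0 l xpredT id).
by rewrite big_seq; apply: bigmax_le => [|l lLo]; apply: LU.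
Qed.

Lemma le_sum_mem (I : eqType) (s : seq I) (F : I -> R) i :
  (forall j, 0 <= F j) -> i \in s -> F i <= \sum_(j <- s) F j.
Proof.
by move=> F0 /perm_to_rem /(perm_big _) ->; rewrite big_cons lerDl sumr_ge0.
Qed.

(** The two disjuncts are the cases of an infeasible and of a feasible system
    of inequalities 0 <= p: a violation of at most v either is bounded below
    by 1 / C or can be repaired by moving each coordinate by at most C v. *)
Definition error_bound (C : R) S : Prop :=
  (forall x (v : R), 0 <= v -> {in S, forall p, - v <= aval p x} ->
     1 <= C * v) \/
  (forall x (v : R), 0 <= v -> {in S, forall p, - v <= aval p x} ->
     exists2 y, {in S, forall p, 0 <= aval p y} &
                forall i, `|x 0 i - y 0 i| <= C * v).

(** Fourier-Motzkin elimination of the variable k. The inequalities without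
    that variable, together with the sums of one lower and one upper bound on
    it, are violated at x by at most a constant times v. By induction they
    have a solution y near x, unless they are infeasible. At y every lower
    bound on the variable k is below every upper bound, and these bounds
    exclude the old value of the variable by at most a constant times v; so a
    new value close to the old one satisfies all of them. *)
Lemma hoffman_upto (k : nat) S :
  (forall p (i : 'I_n), p \in S -> (k <= i)%N -> p.1 0 i = 0) ->
  exists2 C : R, 0 <= C & error_bound C S.
Proof.
elim: k S => [|k IH] S Sk.
  have avE p x : p \in S -> aval p x = p.2.
    by move=> pS; rewrite /aval big1 ?addr0 // => i _; rewrite Sk ?mul0r.
  case: (boolP (all (fun p => 0 <= p.2) S)) => [/allP S0|/allPn[p pS]].
    exists 0 => //; right=> x v v0 xv; exists x => [p pS|i].
      by rewrite avE ?S0.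
    by rewrite subrr normr0 mul0r.
  rewrite -ltNge => p0; exists (- p.2)^-1; first by rewrite invr_ge0; lra.
  left=> x v v0 /(_ p pS); rewrite avE // => pv.
  by rewrite mulrC ler_pdivlMr; lra.
have [kn|nk] := ltnP k n; last first.
  by apply: IH => p i _ ki; move: (leq_trans nk ki); rewrite leqNgt ltn_ord.
pose K := Ordinal kn.
pose S0 := [seq p : 'rV[R]_n * R <- S | p.1 0 K == 0].
pose Sp := [seq p : 'rV[R]_n * R <- S | 0 < p.1 0 K].
pose Sn := [seq p : 'rV[R]_n * R <- S | p.1 0 K < 0].
have [|C C0 HC] := IH (S0 ++ [seq fm_elim K p q | p <- Sp, q <- Sn]).
  move=> p i; rewrite mem_cat => /orP[|/allpairsP[[p1 p2] /= []]].
    rewrite mem_filter => /andP[/eqP pK pS]; rewrite leq_eqVlt.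
    by case/orP => [/eqP ki|/Sk->//]; rewrite -pK; congr (p.1 0 _); apply: val_inj.
  rewrite !mem_filter => /andP[p10 p1S] /andP[p20 p2S] -> ki /=.
  rewrite !mxE; move: ki; rewrite leq_eqVlt => /orP[/eqP ki|ki].
    have -> : i = K by apply: val_inj.
    by rewrite !mulVf ?subrr // ?(gt_eqF p10) ?(lt_eqF p20).
  by rewrite (Sk _ _ p1S ki) (Sk _ _ p2S ki) !mulr0 subrr.
pose D := \sum_(p <- S) `|p.1 0 K|^-1.
pose L := \sum_(p <- S) \sum_i `|p.1 0 i|.
have D0 : 0 <= D by apply: sumr_ge0 => p _; rewrite invr_ge0.
have L0 : 0 <= L by apply: sumr_ge0 => p _; apply: sumr_ge0.
have DS p : p \in S -> `|p.1 0 K|^-1 <= D.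
  by move=> pS; apply: (le_sum_mem _ pS) => q; rewrite invr_ge0.
have LS p : p \in S -> \sum_i `|p.1 0 i| <= L.
  by move=> pS; apply: (le_sum_mem _ pS) => q; apply: sumr_ge0.
have SpP p : p \in Sp -> [/\ p \in S, 0 < p.1 0 K & (p.1 0 K)^-1 <= D].
  rewrite mem_filter => /andP[p0 pS]; split=> //.
  by rewrite -(gtr0_norm p0) DS.
have SnP p : p \in Sn -> [/\ p \in S, p.1 0 K < 0 & - (p.1 0 K)^-1 <= D].
  rewrite mem_filter => /andP[p0 pS]; split=> //.
  by rewrite -invrN -(ltr0_norm p0) DS.
have viol x v : 0 <= v -> {in S, forall p, - v <= aval p x} ->
    {in S0 ++ [seq fm_elim K p q | p <- Sp, q <- Sn],
      forall p, - ((1 + 2 * D) * v) <= aval p x}.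
  move=> v0 xv p; rewrite mem_cat => /orP[|/allpairsP[[p1 p2] /= []]].
    rewrite mem_filter => /andP[_ /xv]; apply: le_trans.
    by rewrite lerN2 mulrDl mul1r lerDl !mulr_ge0.
  move=> /SpP[/xv a1 b1 c1] /SnP[/xv a2 b2 c2] ->; rewrite aval_fm.
  have b1' : 0 <= (p1.1 0 K)^-1 by rewrite invr_ge0 ltW.
  have b2' : 0 <= - (p2.1 0 K)^-1 by rewrite oppr_ge0 invr_le0 ltW.
  by nra.
have CD0 : 0 <= C * (1 + 2 * D) by rewrite mulr_ge0 // addr_ge0 // mulr_ge0.
pose E := D * (1 + L * (C * (1 + 2 * D))).
have E0 : 0 <= E by rewrite mulr_ge0 // addr_ge0 // mulr_ge0.
exists (C * (1 + 2 * D) + E); first exact: addr_ge0.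
case: HC => HC; [left|right] => x v v0 xv.
  have := HC x _ _ (viol x v v0 xv); rewrite mulr_ge0 ?addr_ge0 ?mulr_ge0 //.
  move=> /(_ isT) /le_trans; apply.
  by rewrite mulrA [leRHS]mulrDl lerDl mulr_ge0.
have [|y Sy xy] := HC x _ _ (viol x v v0 xv).
  by rewrite mulr_ge0 ?addr_ge0 ?mulr_ge0.
have {}xy i : `|x 0 i - y 0 i| <= C * (1 + 2 * D) * v.
  rewrite -mulrA; exact: xy.
(* The bound that p puts on the k-th variable when the others are those of y:
   a lower bound for p in Sp, an upper bound for p in Sn. *)
pose bd p := y 0 K - (p.1 0 K)^-1 * aval p y.
have bdE p : p.1 0 K != 0 ->
    bd p = x 0 K - (p.1 0 K)^-1 * aval p (upd y K (x 0 K)).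
  by move=> p0; rewrite /bd aval_upd; field.
have avz p : p \in S -> - ((1 + L * (C * (1 + 2 * D))) * v)
     <= aval p (upd y K (x 0 K)).
  move=> pS; have := xv p pS.
  have: `|aval p x - aval p (upd y K (x 0 K))| <= L * (C * (1 + 2 * D) * v).
    apply: le_trans (@aval_lip p _ _ (C * (1 + 2 * D) * v) _) _ => [i|].
      rewrite mxE; case: eqVneq => [->|_]; last exact: xy.
      by rewrite subrr normr0 mulr_ge0.
    by rewrite ler_wpM2r ?LS // mulr_ge0.
  by rewrite ler_norml => /andP[_]; lra.
have Wge0 : 0 <= (1 + L * (C * (1 + 2 * D))) * v.
  by rewrite mulr_ge0 // addr_ge0 // mulr_ge0.
have EW : E * v = D * ((1 + L * (C * (1 + 2 * D))) * v) by rewrite /E; ring.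
have bdp p : p \in Sp -> bd p <= x 0 K + E * v.
  move=> /SpP[pS p0 pD]; rewrite bdE ?gt_eqF // EW.
  have := avz p pS; have : 0 <= (p.1 0 K)^-1 by rewrite invr_ge0 ltW.
  by nra.
have bdn p : p \in Sn -> x 0 K - E * v <= bd p.
  move=> /SnP[pS p0 pD]; rewrite bdE ?lt_eqF // EW.
  have := avz p pS; have : 0 <= - (p.1 0 K)^-1 by rewrite oppr_ge0 invr_le0 ltW.
  by nra.
have bdpn p q : p \in Sp -> q \in Sn -> bd p <= bd q.
  move=> pS qS; have := Sy (fm_elim K p q).
  rewrite mem_cat (allpairs_f _ pS qS) orbT aval_fm => /(_ isT).
  by rewrite /bd; lra.
have Ev0 : 0 <= E * v by rewrite mulr_ge0.
have [||t [tlo tup]] := @separating_point (x 0 K - E * v :: map bd Sp)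
    (x 0 K + E * v :: map bd Sn) (x 0 K - E * v).
- exact: mem_head.
- move=> l u; rewrite !inE => /orP[/eqP->|/mapP[p pS ->]];
    move=> /orP[/eqP->|/mapP[q qS ->]]; rewrite ?bdn ?bdp ?bdpn //; lra.
exists (upd y K t) => [p pS|i]; last first.
  rewrite mxE mulrDl; case: eqVneq => [->|_]; last first.
    by apply: le_trans (xy i) _; rewrite lerDl.
  have := tlo _ (mem_head _ _); have := tup _ (mem_head _ _).
  have : 0 <= C * (1 + 2 * D) * v by rewrite mulr_ge0.
  by rewrite ler_norml; lra.
rewrite aval_upd; case: (ltrgtP (p.1 0 K) 0) => pK.
- have pSn : p \in Sn by rewrite mem_filter pK.
  have : t <= bd p by apply: tup; rewrite inE map_f ?orbT.
  rewrite /bd -subr_ge0 -(nmulr_rle0 _ pK) !mulrBr mulrA mulfV ?lt_eqF //.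
  by rewrite mul1r; lra.
- have pSp : p \in Sp by rewrite mem_filter pK.
  have : bd p <= t by apply: tlo; rewrite inE map_f ?orbT.
  rewrite /bd -subr_ge0 -(pmulr_rge0 _ pK) !mulrBr mulrA mulfV ?gt_eqF //.
  by rewrite mul1r; lra.
by rewrite pK mul0r addr0 Sy // mem_cat mem_filter pK eqxx pS.
Qed.

Lemma hoffman S :
  exists2 C : R, 0 <= C & error_bound C S.
Proof. by apply: (@hoffman_upto n) => p i _; rewrite leqNgt ltn_ord. Qed.

End Hoffman.

(** * Degree and growth of polynomials *)

Section PolynomialBounds.
Variables (R : realType) (n : nat).
Implicit Types (q u : mpoly n R) (x y : 'rV[R]_n).

Definition affine_part q : 'rV[R]_n * R :=
  (\row_i mcoeff (mnm1 i) q, mcoeff mnm0 q).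

Lemma affine_expansion q : (deg q <= 1)%N ->
  q = mpolyC n (mcoeff mnm0 q)
      + \sum_(i < n) mcoeff (mnm1 i) q *: mpolyX R (mnm1 i).
Proof.
move=> dq; have sq : (msize q <= 2)%N by move: dq; rewrite /deg; case: (msize q).
apply/mpolyP => m; rewrite mcoeffD mcoeffC raddf_sum /=.
under eq_bigr do rewrite mcoeffZ mcoeffX.
case: (ltngtP (mdeg m) 1%N) => dm.
- have /eqP -> : m == mnm0 by rewrite -mdeg_eq0 -leqn0 -ltnS.
  rewrite eqxx mulr1 big1 ?addr0 // => i _.
  by rewrite mnm1_eq0 mulr0.
- rewrite memN_msupp_eq0; last by apply: msize_mdeg_ge; apply: leq_trans dm.
  rewrite big1 => [|i _].
    by rewrite -mdeg_eq0; case: (mdeg m) dm => // k _; rewrite mulr0 addr0.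
  case: eqVneq => [E|_]; last by rewrite mulr0.
  by move: dm; rewrite -E mdeg1.
- have /mdeg1P [i /eqP ->] : mdeg m == 1%N by apply/eqP.
  rewrite mnm1_eq0 mulr0 add0r (bigD1 i) //= eqxx mulr1 big1 ?addr0 // => j ji.
  case: eqVneq => [E|_]; last by rewrite mulr0.
  by move/mnmP: E => /(_ i); rewrite !mnm1E eqxx (negbTE ji).
Qed.

Lemma peval_affine q x : (deg q <= 1)%N -> peval q x = aval (affine_part q) x.
Proof.
move=> /affine_expansion E; rewrite /peval {1}E mevalD mevalC raddf_sum /= /aval.
by congr (_ + _); apply: eq_bigr => i _; rewrite mevalZ mevalXU mxE.
Qed.

Lemma affine_part_neq0 q : deg q = 1%N -> (affine_part q).1 != 0.
Proof.
move=> dq; apply/eqP => /rowP q0.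
have := dq; rewrite (affine_expansion (eq_leq dq)) big1 => [|i _].
  by rewrite addr0 /deg mmeasureC; case: eqP.
by have := q0 i; rewrite !mxE => ->; rewrite scale0r.
Qed.

Lemma deg_le_mdeg q m : m \in msupp q -> (mdeg m <= deg q)%N.
Proof. by move=> /msize_mdeg_lt; rewrite /deg; case: (msize q). Qed.

Lemma degD q u : (deg (q + u)%R <= maxn (deg q) (deg u))%N.
Proof.
rewrite /deg; have : (msize (q + u)%R <= maxn (msize q) (msize u))%N.
  exact: mmeasureD_le.
by case: (msize q) (msize u) (msize (q + u)) => [|a] [|b] [|c] //=;
  rewrite ?maxnSS ?max0n ?maxn0.
Qed.

Lemma degM q u : (deg (q * u)%R <= deg q + deg u)%N.
Proof.
have [->|q0] := eqVneq q 0; first by rewrite mul0r /deg mmeasure0.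
have [->|u0] := eqVneq u 0; first by rewrite mulr0 /deg mmeasure0.
rewrite /deg msizeM //; move: q0 u0; rewrite -(msize_poly_eq0 q) -(msize_poly_eq0 u).
by case: (msize q) => // a; case: (msize u) => // b; rewrite addSn addnS.
Qed.

Lemma degX q k : (deg (q ^+ k)%R <= k * deg q)%N.
Proof.
elim: k => [|k IH]; first by rewrite expr0 /deg mmeasure1.
by rewrite exprS mulSn (leq_trans (degM _ _)) // leq_add2l.
Qed.

Lemma degZ a q : (deg (a *: q)%R <= deg q)%N.
Proof. by rewrite /deg -!subn1 leq_sub2r // mmeasureZ_le. Qed.

Lemma deg_sum (I : Type) (r : seq I) (P : pred I) (F : I -> mpoly n R) k :
  (forall i, P i -> (deg (F i) <= k)%N) -> (deg (\sum_(i <- r | P i) F i)%R <= k)%N.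
Proof.
move=> Fk; elim/big_rec: _ => [|i q Pi qk]; first by rewrite /deg mmeasure0.
by rewrite (leq_trans (degD _ _)) // geq_max qk Fk.
Qed.

(** The three estimates are proved together because they are stable under
    products: a a' - b b' = a (a' - b') + (a - b) b'. *)
Lemma monomial_bounds (m : multinom n) x y (M e : R) :
  1 <= M -> 0 <= e ->
  (forall i, `|x 0 i| <= M) -> (forall i, `|y 0 i| <= M) ->
  (forall i, `|x 0 i - y 0 i| <= e) ->
  [/\ `|\prod_i x 0 i ^+ m i| <= M ^+ mdeg m,
      `|\prod_i y 0 i ^+ m i| <= M ^+ mdeg m &
      `|\prod_i x 0 i ^+ m i - \prod_i y 0 i ^+ m i|
        <= (mdeg m)%:R * M ^+ mdeg m * e].
Proof.
move=> M1 e0 xM yM xy.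
have M0 k : 0 <= M ^+ k by rewrite exprn_ge0 // (le_trans ler01).
pose ok (a b : R) (k : nat) :=
  [/\ `|a| <= M ^+ k, `|b| <= M ^+ k & `|a - b| <= k%:R * M ^+ k * e].
have okM a b k a' b' k' : ok a b k -> ok a' b' k' -> ok (a * a') (b * b') (k + k')%N.
  move=> [ha hb hab] [ha' hb' hab']; split.
  - by rewrite normrM exprD ler_pM.
  - by rewrite normrM exprD ler_pM.
  have -> : a * a' - b * b' = a * (a' - b') + (a - b) * b' by ring.
  apply: le_trans (ler_normD _ _) _; rewrite !normrM.
  apply: le_trans (lerD (ler_pM _ _ ha hab') (ler_pM _ _ hab hb')) _ => //.
  by rewrite exprD natrD le_eqVlt; apply/orP; left; apply/eqP; ring.
have ok0 : ok 1 1 0%N by split; rewrite ?normr1 ?subrr ?normr0 ?mul0r ?expr0.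
have okX k i : ok (x 0 i ^+ k) (y 0 i ^+ k) k.
  elim: k => [|k IH]; first by rewrite !expr0.
  rewrite !exprS -(add1n k); apply: okM => //; split; rewrite ?expr1 //.
  rewrite mul1r; apply: le_trans (xy i) _.
  by rewrite ler_peMl.
suff : ok (\prod_i x 0 i ^+ m i) (\prod_i y 0 i ^+ m i) (mdeg m) by [].
rewrite mdegE; elim/big_ind3: _ => // a b k a' b' k'; exact: okM.
Qed.

Definition coef_norm u : R := \sum_(m <- msupp u) `|mcoeff m u|.

Lemma coef_norm_ge0 u : 0 <= coef_norm u.
Proof. exact: sumr_ge0. Qed.

Lemma peval_bound u x (M : R) : 1 <= M -> (forall i, `|x 0 i| <= M) ->
  `|peval u x| <= coef_norm u * M ^+ deg u.
Proof.
move=> M1 xM; rewrite /peval mevalE mulr_suml.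
apply: le_trans (ler_norm_sum _ _ _) _; rewrite big_seq [leRHS]big_seq.
apply: ler_sum => m mu; rewrite normrM ler_wpM2l //.
have [|h _ _] := @monomial_bounds m x x M 0 M1 (lexx 0) xM xM.
  by move=> i; rewrite subrr normr0.
by apply: le_trans h _; rewrite ler_weXn2l // deg_le_mdeg.
Qed.

Lemma peval_lip u x y (M e : R) : 1 <= M -> 0 <= e ->
  (forall i, `|x 0 i| <= M) -> (forall i, `|y 0 i| <= M) ->
  (forall i, `|x 0 i - y 0 i| <= e) ->
  `|peval u x - peval u y| <= coef_norm u * ((deg u)%:R * M ^+ deg u * e).
Proof.
move=> M1 e0 xM yM xy; rewrite /peval !mevalE -sumrB mulr_suml.
apply: le_trans (ler_norm_sum _ _ _) _; rewrite big_seq [leRHS]big_seq.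
apply: ler_sum => m mu; rewrite -mulrBr normrM ler_wpM2l //.
have [_ _ h] := monomial_bounds m M1 e0 xM yM xy.
apply: le_trans h _; rewrite ler_wpM2r // ler_pM ?ler_nat ?deg_le_mdeg //.
  by rewrite exprn_ge0 // (le_trans ler01).
by rewrite ler_weXn2l // deg_le_mdeg.
Qed.

(** A polynomial that dominates all coordinates, so that its d-th power, of
    degree 2 d, dominates every polynomial of degree d. *)
Definition growth : mpoly n R :=
  1 + \sum_(i < n) (mpolyX R (mnm1 i)) ^+ 2.

Lemma deg_growth : (deg growth <= 2)%N.
Proof.
rewrite (leq_trans (degD _ _)) // geq_max {1}/deg mmeasure1 /=.
apply: deg_sum => i _; rewrite (leq_trans (degX _ _)) //.
by rewrite /deg mmeasureX /= mdeg1.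
Qed.

Lemma growthE x : peval growth x = 1 + \sum_i x 0 i ^+ 2.
Proof.
rewrite /peval mevalD meval1 raddf_sum; congr (_ + _); apply: eq_bigr => i _.
by rewrite -[RHS]/(_ * _) -[X in _ = X * X](mevalXU (fun i => x ord0 i)) -mevalM.
Qed.

Lemma growth_ge1 x : 1 <= peval growth x.
Proof. by rewrite growthE lerDl sumr_ge0 // => i _; rewrite sqr_ge0. Qed.

Lemma coord_le_growth x i : `|x 0 i| <= peval growth x.
Proof.
have : `|x 0 i| <= 1 + x 0 i ^+ 2.
  by rewrite -(real_normK (num_real (x 0 i))); have := sqr_ge0 (`|x 0 i| - 1); nra.
move=> h; apply: le_trans h _; rewrite growthE lerD2l (bigD1 i) //= lerDl.
by rewrite sumr_ge0 // => j _; rewrite sqr_ge0.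
Qed.

End PolynomialBounds.

(** * Max-definable functions *)

Section MaxDefinable.
Variables (R : realType) (n : nat).
Implicit Types (f g : 'rV[R]_n -> R) (q : mpoly n R).

Lemma max_definable_opp f : max_definable f -> max_definable (fun x => - f x).
Proof.
move=> /(MaxDefScale (-1)); congr max_definable.
by apply/funext => x; rewrite mulN1r.
Qed.

Lemma max_definable_min f g : max_definable f -> max_definable g ->
  max_definable (fun x => Num.min (f x) (g x)).
Proof.
move=> /max_definable_opp hf /max_definable_opp hg.
have := max_definable_opp (MaxDefMax hf hg); congr max_definable.
by apply/funext => x; rewrite oppr_max !opprK.
Qed.

Lemma max_definable_big (op : R -> R -> R) (I : Type) (r : seq I)
    f (F : I -> 'rV[R]_n -> R) :
  (forall g h, max_definable g -> max_definable h ->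
     max_definable (fun x => op (g x) (h x))) ->
  max_definable f -> (forall i, max_definable (F i)) ->
  max_definable (fun x => \big[op/f x]_(i <- r) F i x).
Proof.
move=> hop hf hF; elim: r => [|i r IH].
  by under eq_fun do rewrite big_nil.
under eq_fun do rewrite big_cons.
exact: hop.
Qed.

Lemma max_definable_exp f k : max_definable f -> max_definable (fun x => f x ^+ k).
Proof.
move=> hf; elim: k => [|k IH]; first exact: MaxDefConst.
by under eq_fun do rewrite exprS; apply: MaxDefMul.
Qed.

Lemma max_definable_peval q : max_definable (peval q).
Proof.
have -> : peval q = (fun x => \sum_(m <- msupp q)
    mcoeff m q * \prod_i x ord0 i ^+ m i).
  by apply/funext => x; rewrite /peval mevalE.
apply: (@max_definable_big +%R) => [g h|| m]; [exact: MaxDefAdd| |].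
  exact: MaxDefConst.
apply: MaxDefScale; apply: (@max_definable_big *%R) => [g h|| i].
- exact: MaxDefMul.
- exact: MaxDefConst.
- exact/max_definable_exp/MaxDefCoord.
Qed.

Lemma max_definable_max_min (p : nat) (F : 'I_p.+1 -> 'I_p.+1 -> mpoly n R) :
  max_definable (fun x => fin_max (fun i => fin_min (fun j => peval (F i j) x))).
Proof.
have hmin i : max_definable (fun x => fin_min (fun j => peval (F i j) x)).
  apply: (@max_definable_big Num.min); first exact: max_definable_min.
    exact: max_definable_peval.
  by move=> j; exact: max_definable_peval.
by apply: (@max_definable_big Num.max); first exact: MaxDefMax.
Qed.

Lemma max_definable_continuous f : max_definable f -> continuous f.
Proof.
elim=> [i|a|g h _ cg _ ch|g h _ cg _ ch|g h _ cg _ ch|a g _ cg] x.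
- exact: (@coord_continuous _ 1 n ord0 i).
- exact: cst_continuous.
- exact: (@continuousD _ _ _ g h x (cg x) (ch x)).
- exact: (@continuousM _ _ g h x (cg x) (ch x)).
- exact: (@continuous_max _ _ g h x (cg x) (ch x)).
- exact: (@continuousM _ _ (cst a) g x (@cst_continuous _ _ a x) (cg x)).
Qed.

(** This replaces density arguments: a point where two continuous functions
    are to be compared need only be the origin of a ray that starts in a set
    where they are known to agree. *)
Lemma eq_of_ray f g (x v : 'rV[R]_n) : continuous f -> continuous g ->
  (\forall s \near 0^'+, f (x + s *: v) = g (x + s *: v)) -> f x = g x.
Proof.
move=> cf cg fg.
have ray (h : 'rV[R]_n -> R) : continuous h ->
    h (x + s *: v) @[s --> 0^'+] --> h x.
  move=> ch; apply: cvg_at_right_filter.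
  have {2}-> : x = x + (0 : R) *: v by rewrite scale0r addr0.
  apply: (@continuous_comp _ _ _ (fun s : R => x + s *: v) h); last exact: ch.
  by apply: cvgD; [exact: cvg_cst | exact: scalel_continuous].
have := ray f cf; have := ray g cg.
move=> hg hf; apply: (@cvg_unique _ _ _ _ _ _ hf) => //.
apply: cvg_trans hg; apply: near_eq_cvg.
by apply: filterS fg => s ->.
Qed.

End MaxDefinable.

(** * Cells of the hyperplane arrangement *)

Section Cells.
Variables (R : realType) (n b : nat) (pi : 'I_b -> mpoly n R).
Hypothesis pi_affine : forall j, deg (pi j) = 1%N.
Implicit Types (A B : {set 'I_b}) (x y z v : 'rV[R]_n).

Definition side A (j : 'I_b) : R := if j \in A then 1 else -1.

Definition cell A : set 'rV[R]_n :=
  [set x | forall j, 0 < side A j * peval (pi j) x].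

Definition slope v (j : 'I_b) : R := \sum_i (affine_part (pi j)).1 0 i * v 0 i.

Lemma peval_line j x v s :
  peval (pi j) (x + s *: v) = peval (pi j) x + s * slope v j.
Proof.
rewrite !peval_affine ?pi_affine // /aval -addrA; congr (_ + _).
rewrite mulr_sumr -big_split; apply: eq_bigr => i _; rewrite !mxE /=; ring.
Qed.

Lemma peval_segment j x y s :
  peval (pi j) (x + s *: (y - x)) =
  (1 - s) * peval (pi j) x + s * peval (pi j) y.
Proof.
have := peval_line j x (y - x) 1; rewrite scale1r addrC subrK mul1r => ->.
by rewrite peval_line; ring.
Qed.

(** The segment from a point y that satisfies the weak inequalities to a point
    of the cell lies in the cell except possibly for y. *)
Lemma eq_on_closed_cell A (f : 'rV[R]_n -> R) (q : mpoly n R) y :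
  continuous f -> cell A !=set0 -> coincide_on (cell A) f q ->
  (forall j, 0 <= side A j * peval (pi j) y) -> f y = peval q y.
Proof.
move=> cf [z Az] fq Ay; apply: (@eq_of_ray _ _ _ _ y (z - y)) => //.
  exact/max_definable_continuous/max_definable_peval.
near=> s; apply: fq => j; rewrite peval_segment.
have s0 : 0 < s by near: s; exact: nbhs_right_gt.
have s1 : s <= 1 by near: s; exact: nbhs_right_le.
by have := Az j; have := Ay j; nra.
Unshelve. all: by end_near. Qed.

(** The polynomial is gB + kappa * l * N^d, where l is the sum of the separating
    affine functions, oriented towards B. That kappa exists is Hoffman's error
    bound for the closed cells of A and B: on their intersection gA and gB
    agree with f. Degree 2 d of the factor N^d leaves one degree for l. *)
Lemma separating_poly A B (f : 'rV[R]_n -> R) (gA gB : mpoly n R) (d : nat) :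
  continuous f -> cell A !=set0 -> cell B !=set0 ->
  coincide_on (cell A) f gA -> coincide_on (cell B) f gB ->
  (deg gA <= d)%N -> (deg gB <= d)%N ->
  exists h : mpoly n R, [/\ (deg h <= 2 * d + 1)%N,
    (forall x, cell A x -> peval h x <= f x) &
    (forall x, cell B x -> f x <= peval h x)].
Proof.
move=> cf A0 B0 fA fB dA dB.
pose l := \sum_(j | (j \in A) != (j \in B)) side B j *: pi j.
pose v x := - peval l x.
have plE x : peval l x = \sum_(j | (j \in A) != (j \in B)) side B j * peval (pi j) x.
  by rewrite /peval raddf_sum; apply: eq_bigr => j _; rewrite /= mevalZ.
have vE x : v x = \sum_(j | (j \in A) != (j \in B)) side A j * peval (pi j) x.
  rewrite /v plE -sumrN; apply: eq_bigr => j; rewrite /side.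
  by case: (j \in A); case: (j \in B) => //= _; rewrite mulNr ?opprK.
have dl : (deg l <= 1)%N.
  by apply: deg_sum => j _; rewrite (leq_trans (degZ _ _)) // pi_affine.
(* The inequalities of both closed cells; on the cell A, only those of B for a
   separating hyperplane can fail, by at most v. *)
pose S := [seq affine_part (side C j *: pi j) | C <- [:: A; B], j <- enum 'I_b].
have SE C j x : aval (affine_part (side C j *: pi j)) x = side C j * peval (pi j) x.
  rewrite -peval_affine ?(leq_trans (degZ _ _)) ?pi_affine //.
  by rewrite /peval mevalZ.
have vS x : cell A x -> 0 <= v x /\ {in S, forall p, - v x <= aval p x}.
  move=> Ax; have v0 : 0 <= v x by rewrite vE sumr_ge0 // => j _; exact: ltW.
  split=> // p /allpairsP[[C j] /= [CAB _ ->]]; rewrite SE.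
  have Aj : 0 < side A j * peval (pi j) x := Ax j.
  have [E|jAB] := eqVneq (j \in A) (j \in B).
    have -> : side C j = side A j.
      by move: CAB; rewrite !inE /side => /orP[/eqP->|/eqP->] //; rewrite E.
    by apply: le_trans (ltW Aj); rewrite oppr_le0.
  have : side A j * peval (pi j) x <= v x.
    by rewrite vE (bigD1 j) //= lerDl sumr_ge0 // => i _; exact: ltW.
  move: Aj; rewrite /side; case: (j \in A); case: (j \in C); lra.
have [C C0 HC] := hoffman S.
pose u := gA - gB.
have du : (deg u <= d)%N.
  by rewrite (leq_trans (degD _ _)) // geq_max dA /deg mmeasureN.
pose N x := peval (growth R n) x.
have N1 x : 1 <= N x := growth_ge1 x.
have N0 x : 0 <= N x := le_trans ler01 (N1 x).
pose cl := coef_norm l; have cl0 : 0 <= cl := coef_norm_ge0 l.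
pose cu := coef_norm u; have cu0 : 0 <= cu := coef_norm_ge0 u.
have vN x : v x <= cl * N x.
  have /(_ l) h := fun w => peval_bound w (N1 x) (coord_le_growth x).
  apply: le_trans (le_trans _ h) _; first by rewrite /v -normrN ler_norm.
  by rewrite ler_wpM2l // -[leRHS]expr1 ler_weXn2l.
(* The solution y near x satisfies |y_i| <= |x_i| + C v x <= m N x. *)
pose m := 1 + C * cl; have m1 : 1 <= m by rewrite lerDl mulr_ge0.
pose kappa := cu * (d%:R * m ^+ d * C) + cu * C.
have key x : cell A x -> `|peval u x| <= kappa * (v x * N x ^+ d).
  move=> Ax; have [v0 xS] := vS x Ax.
  have Nd0 : 0 <= N x ^+ d by rewrite exprn_ge0.
  have md0 : 0 <= m ^+ d by rewrite exprn_ge0 // (le_trans ler01).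
  rewrite mulrDl; case: HC => HC.
    have h1 : `|peval u x| <= cu * N x ^+ d.
      apply: le_trans (peval_bound _ (N1 x) (coord_le_growth x)) _.
      by rewrite ler_wpM2l // ler_weXn2l.
    apply: (le_trans h1); rewrite -[leLHS]add0r lerD //.
      by rewrite !mulr_ge0.
    rewrite -mulrA ler_wpM2l // mulrA ler_peMl // mulrC.
    by have := HC x _ v0 xS; rewrite mulrC.
  have [y Sy xy] := HC x _ v0 xS.
  have y0 D j : D \in [:: A; B] -> 0 <= side D j * peval (pi j) y.
    by move=> hD; rewrite -SE; apply: Sy; apply: allpairs_f; rewrite ?mem_enum.
  have uy : peval u y = 0.
    rewrite /peval mevalB -!/(peval _ _) -(eq_on_closed_cell cf A0 fA) => [|j].
      rewrite -(eq_on_closed_cell cf B0 fB) ?subrr // => j.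
      by apply: y0; rewrite !inE eqxx orbT.
    by apply: y0; rewrite !inE eqxx.
  have xM i : `|x 0 i| <= m * N x.
    by apply: le_trans (coord_le_growth x i) _; rewrite ler_peMl.
  have yM i : `|y 0 i| <= m * N x.
    have -> : y 0 i = x 0 i - (x 0 i - y 0 i) by ring.
    apply: le_trans (ler_normB _ _) _; rewrite mulrDl mul1r -mulrA.
    by rewrite lerD ?coord_le_growth // (le_trans (xy i)) // ler_wpM2l.
  have M1 : 1 <= m * N x by rewrite mulr_ege1.
  have := @peval_lip _ _ u x y _ (C * v x) M1 (mulr_ge0 C0 v0) xM yM xy.
  rewrite uy subr0 => h; apply: (le_trans h).
  rewrite -[leLHS]addr0 lerD ?mulr_ge0 // -[leRHS]mulrA ler_wpM2l //.
  have -> : d%:R * m ^+ d * C * (v x * N x ^+ d) =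
            d%:R * (m * N x) ^+ d * (C * v x) by rewrite exprMn; ring.
  rewrite ler_wpM2r ?mulr_ge0 // ler_pM ?ler_nat //.
    by rewrite exprn_ge0 // (le_trans ler01).
  by rewrite ler_weXn2l.
have kappa0 : 0 <= kappa.
  by rewrite addr_ge0 ?mulr_ge0 // exprn_ge0 // (le_trans ler01).
have hE x : peval (gB + kappa *: (l * growth R n ^+ d)) x =
            peval gB x - kappa * (v x * N x ^+ d).
  rewrite /peval mevalD mevalZ mevalM rmorphXn /= /v /N /peval; ring.
exists (gB + kappa *: (l * growth R n ^+ d)); split=> [|x Ax|x Bx].
- rewrite (leq_trans (degD _ _)) // geq_max; apply/andP; split.
    by rewrite (leq_trans dB) // mulSn mul1n -addnA leq_addr.
  rewrite (leq_trans (degZ _ _)) // (leq_trans (degM _ _)) // addnC leq_add //.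
  rewrite (leq_trans (degX _ _)) // mulnC leq_mul2r.
  by rewrite deg_growth orbT.
- rewrite hE fA //; have := key x Ax.
  by rewrite /u /peval mevalB ler_norml => /andP[]; lra.
- rewrite hE fB // lerDl oppr_ge0 mulr_ge0_le0 // mulr_le0_ge0 ?exprn_ge0 //.
  rewrite /v oppr_le0 plE sumr_ge0 // => j _; exact: ltW.
Qed.

(** On the moment curve (1, t, t^2, ...) the slopes are nonzero polynomials in
    t, whose product has a nonroot. *)
Lemma generic_direction : exists v, forall j, slope v j != 0.
Proof.
pose P j : {poly R} := \sum_(i < n) (affine_part (pi j)).1 0 i *: 'X^i.
have P0 j : P j != 0.
  apply: contra (affine_part_neq0 (pi_affine j)) => /eqP Pj.
  apply/eqP/rowP => i; rewrite [RHS]mxE -[RHS](coef0 R i) -Pj coef_sum.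
  rewrite (bigD1 i) //= big1 => [|k ki]; rewrite coefZ coefXn.
    by rewrite eqxx mulr1 addr0.
  by rewrite eq_sym -[_ == _]/(k == i) (negbTE ki) mulr0.
pose Q := \prod_j P j.
have Q0 : Q != 0 by apply/prodf_neq0.
have [t tQ] : exists t, ~~ root Q t.
  apply: contrapT => noroot.
  have /(max_poly_roots Q0) : all (root Q) [seq k%:R | k <- iota 0 (size Q)].
    apply/allP => t _; apply: contrapT => /negP tQ; apply: noroot; by exists t.
  rewrite map_inj_uniq ?iota_uniq; last exact: mulrIn.
  by rewrite size_map size_iota ltnn => /(_ isT).
exists (\row_i t ^+ i) => j; move: tQ.
rewrite /root horner_prod => /prodf_neq0/(_ j isT).
rewrite horner_sum; congr (_ != 0); apply: eq_bigr => i _.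
by rewrite hornerZ hornerXn !mxE.
Qed.

Definition sign_set x : {set 'I_b} := [set j | 0 < peval (pi j) x]%SET.

(** On a line in a generic direction each pi_j vanishes at one point at most.
    So every point is the origin of a ray that starts in a cell: the cells
    are dense. *)
Lemma near_generic v x : (forall j, slope v j != 0) ->
  \forall s \near 0^'+, cell (sign_set (x + s *: v)) (x + s *: v).
Proof.
move=> v0.
suff : \forall s \near (0 : R)^'+, forall j, peval (pi j) (x + s *: v) != 0.
  apply: filterS => s hs j; rewrite /side inE.
  have [|pos|/esym/eqP p0] := ltrgtP 0 (peval (pi j) (x + s *: v)).
  - by rewrite mul1r.
  - by rewrite mulN1r oppr_gt0.
  - by move: (hs j); rewrite p0.
apply: filter_forall => j; pose s0 := - peval (pi j) x / slope v j.
have hs0 s : s != s0 -> peval (pi j) (x + s *: v) != 0.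
  apply: contra => /eqP; rewrite peval_line => E; apply/eqP.
  by rewrite /s0 -[LHS](mulfK (v0 j)); congr (_ / _); lra.
have [s00|s00] := ltP 0 s0; near=> s; apply: hs0.
- by rewrite lt_eqF //; near: s; exact: nbhs_right_lt.
- by rewrite gt_eqF // (le_lt_trans s00) //; near: s; exact: nbhs_right_gt.
Unshelve. all: by end_near. Qed.

Lemma near_cell A z : cell A z ->
  \forall s \near 0^'+, forall i, cell A (z + s *: delta_mx 0 i).
Proof.
move=> Az; apply: filter_forall => i; apply: filter_forall => j.
pose a := side A j * peval (pi j) z; pose c := `|slope (delta_mx 0 i) j| + 1.
have a0 : 0 < a by exact: Az.
have c0 : 0 < c by rewrite ltr_wpDl.
near=> s.
have s0 : 0 < s by near: s; exact: nbhs_right_gt.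
have sa : s < a / c by near: s; apply: nbhs_right_lt; rewrite divr_gt0.
rewrite peval_line mulrDr -/a.
move: sa; rewrite ltr_pdivlMr // => sa.
have : `|side A j * (s * slope (delta_mx 0 i) j)| <= s * c.
  have -> : `|side A j * (s * slope (delta_mx 0 i) j)| =
            s * `|slope (delta_mx 0 i) j|.
    rewrite !normrM (gtr0_norm s0) /side.
    by case: (j \in A); rewrite ?normrN normr1 mul1r.
  by rewrite ler_wpM2l ?(ltW s0) // lerDl.
rewrite ler_norml => /andP[]; lra.
Unshelve. all: by end_near. Qed.

Definition theta_of A : Theta b :=
  [ffun j => if j \in A then @SeqSub _ [:: 1 : int; 0; -1] 1 isT
             else @SeqSub _ [:: 1 : int; 0; -1] (-1) isT].

Lemma cell_sub_piece A : cell A `<=` piece pi (theta_of A).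
Proof.
move=> x Ax j; have := Ax j; rewrite ffunE /side; case: (j \in A) => /=.
  by rewrite mul1r => /gtr0_sgz.
by rewrite mulN1r oppr_gt0 => /ltr0_sgz.
Qed.

(** A cell is open, so it contains a point together with its translates by a
    small multiple of each basis vector. *)
Lemma chamber_cell A : cell A !=set0 -> chamber pi (theta_of A).
Proof.
move=> [z Az]; split; last first.
  move=> l u _ /eqP <-; exact: rank_leq_col.
near (0 : R)^'+ => s.
have s0 : 0 < s by near: s; exact: nbhs_right_gt.
have cs : forall i, cell A (z + s *: delta_mx 0 i) by near: s; exact: near_cell.
exists (fun k => if unlift ord0 k is Some i then z + s *: delta_mx 0 i else z).
split=> [k|].
  by apply: cell_sub_piece; case: (unlift ord0 k) => [i|].
rewrite /affinely_independent.
have -> : \matrix_(i < n) ((if unlift ord0 (lift ord0 i) is Some i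
    then z + s *: delta_mx 0 i else z) -
    (if unlift ord0 (ord0 : 'I_n.+1) is Some i then z + s *: delta_mx 0 i else z))
    = s%:M :> 'M[R]_n.
  apply/matrixP => i k; rewrite mxE liftK unlift_none addrC addKr !mxE eqxx /=.
  by rewrite eq_sym; case: eqP; rewrite ?mulr1 ?mulr0.
by rewrite row_free_unit unitmxE det_scalar unitrX // unitfE gt_eqF.
Unshelve. all: by end_near. Qed.

Definition nonempty_cells : {set {set 'I_b}} :=
  [set A : {set 'I_b} | `[< cell A !=set0 >]]%SET.

Lemma nonempty_cellsP A : (A \in nonempty_cells) = `[< cell A !=set0 >].
Proof. by rewrite inE. Qed.

(** Given more than n indices there is a nonzero c with sum c_i pi_i constant,
    because the linear parts live in dimension n; replacing c by its opposite,
    the constant is at most 0. A cell on which pi_i is positive exactly when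
    c_i is would make the sum positive. *)
Lemma shattered_card J : shatters nonempty_cells J -> (#|J| < n.+1)%N.
Proof.
move=> shJ; rewrite ltnS leqNgt; apply/negP => nJ.
pose p i := affine_part (pi (@enum_val _ (mem J) i)).
pose M : 'M[R]_(#|J|, n) := \matrix_i (p i).1.
have [c0 [c00 c0M]] : exists c : 'rV[R]_#|J|, c != 0 /\ c *m M = 0.
  have : kermx M != 0.
    rewrite kermx_eq0 /row_free neq_ltn; apply/orP; left.
    exact: leq_ltn_trans (rank_leq_col M) nJ.
  by case/rowV0Pn => c /sub_kermxP cM c0; exists c.
have [c [cn0 cM ck]] : exists c : 'rV[R]_#|J|, [/\ c != 0, c *m M = 0 &
    \sum_i c 0 i * (p i).2 <= 0].
  have [le0|gt0] := leP (\sum_i c0 0 i * (p i).2) 0; first by exists c0.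
  exists (- c0); rewrite oppr_eq0 mulNmx c0M oppr0; split=> //.
  under eq_bigr do rewrite mxE mulNr.
  by rewrite sumrN oppr_le0 ltW.
pose B := [set enum_val i | i in [set i | 0 < c 0 i]]%SET.
have BJ : B \subset J.
  by apply/fintype.subsetP => j /imsetP[i _ ->]; exact: enum_valP.
have [A] := shJ B BJ; rewrite nonempty_cellsP => /asboolP[x Ax] AJB.
have Ac i : (enum_val i \in A) = (0 < c 0 i).
  have : (enum_val i \in A :&: J) = (enum_val i \in B) by rewrite AJB.
  rewrite inE enum_valP andbT => ->; apply/imsetP/idP => [[k]|ci].
    by rewrite inE => + /enum_val_inj ->.
  by exists i; rewrite ?inE.
have sumE : \sum_i c 0 i * peval (pi (enum_val i)) x = \sum_i c 0 i * (p i).2.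
  under eq_bigr do rewrite peval_affine ?pi_affine // /aval mulrDr -/(p _).
  rewrite big_split /= -[RHS]addr0; congr (_ + _).
  under eq_bigr do rewrite mulr_sumr.
  rewrite exchange_big big1 //= => k _.
  have := congr1 (fun N : 'rV_n => N 0 k * x 0 k) cM.
  rewrite !mxE mul0r mulr_suml => E; rewrite -[RHS]E.
  by apply: eq_bigr => i _; rewrite !mxE mulrA.
have pos i : c 0 i != 0 -> 0 < c 0 i * peval (pi (enum_val i)) x.
  have := Ax (enum_val i); rewrite /side Ac.
  have [ci|ci|//] := ltrgtP 0 (c 0 i).
  - by rewrite mul1r => px _; rewrite mulr_gt0.
  - by rewrite mulN1r oppr_gt0 => px _; rewrite nmulr_rgt0.
have [i ci] : exists i, c 0 i != 0.
  apply: contrapT => h; move/negP: cn0; apply; apply/eqP/rowP => i.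
  by rewrite mxE; apply: contrapT => /eqP ci; apply: h; exists i.
have : 0 < \sum_i c 0 i * peval (pi (enum_val i)) x.
  rewrite (bigD1 i) //= ltr_pwDl ?pos // sumr_ge0 // => k _.
  have [->|ck0] := eqVneq (c 0 k) 0; first by rewrite mul0r.
  exact: ltW (pos k ck0).
by rewrite sumE ltNge ck.
Qed.

Lemma card_nonempty_cells : (0 < b)%N ->
  (#|nonempty_cells| <= n.+1 * b ^ n)%N.
Proof.
move=> b0; apply: leq_trans (sum_bin_le n b0).
have := @sauer_shelah _ n.+1 (finset.setTfor 'I_b) nonempty_cells.
rewrite cardsT card_ord; apply; last exact: shattered_card.
by move=> A _; exact: finset.subsetT.
Qed.

End Cells.

(** * The max-min representation *)

Lemma fin_max_eq (R : realType) p (u : 'I_p.+1 -> R) a i :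
  (forall k, u k <= a) -> u i = a -> fin_max u = a.
Proof.
move=> ua ui; apply: le_anti; apply/andP; split; first exact: bigmax_le.
by rewrite -ui le_bigmax.
Qed.

Lemma fin_min_ge (R : realType) p (u : 'I_p.+1 -> R) a :
  (forall k, a <= u k) -> a <= fin_min u.
Proof. by move=> ua; apply: le_bigmin. Qed.

Lemma fin_min_le (R : realType) p (u : 'I_p.+1 -> R) k : fin_min u <= u k.
Proof. exact: bigmin_le. Qed.

Theorem theorem4p2 (R : realType) (n : nat) (hn : (1 <= n)%N) :
  exists c : R, 0 < c /\
  forall (b : nat) (hb : (1 <= b)%N)
    (pi : 'I_b -> mpoly n R) (hpi : forall i, deg (pi i) = 1%N)
    (f : 'rV[R]_n -> R) (hf : spline pi f)
    (g : Theta b -> mpoly n R)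
    (hg : forall theta, chamber pi theta ->
            coincide_on (piece pi theta) f (g theta))
    (d : nat) (hd : d = max_deg_on_chambers pi g),
  max_definable f /\
  exists (p' : nat) (F : 'I_p'.+1 -> 'I_p'.+1 -> mpoly n R),
    let p := p'.+1 in
    [/\ forall x, f x = fin_max (fun i => fin_min (fun j => peval (F i j) x)),
        forall i j, (deg (F i j) <= 2 * d + 1)%N
      & (1 <= d)%N -> p%:R <= c * b%:R ^+ (2 * n ^ 2) * d%:R ^+ n].
Proof.
exists n.+1%:R; split=> [|b b1 pi pi1 f [cf _] g hg d hd]; first by rewrite ltr0n.
suff [p' [F [fF dF pF]]] : exists (p' : nat) (F : 'I_p'.+1 -> 'I_p'.+1 -> mpoly n R),
    [/\ forall x, f x = fin_max (fun i => fin_min (fun j => peval (F i j) x)),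
        forall i j, (deg (F i j) <= 2 * d + 1)%N
      & (p'.+1 <= n.+1 * b ^ n)%N].
  split.
    by rewrite (funext fF); exact: max_definable_max_min.
  exists p', F => p; split=> // d1.
  rewrite -!natrX -!natrM ler_nat (leq_trans pF) //.
  rewrite -[X in (X <= _)%N]muln1 leq_mul // ?expn_gt0 ?d1 //.
  by rewrite leq_mul2l leq_pexp2l // mulnC -mulnn -mulnA leq_pmulr // muln_gt0 hn.
have gcell A : cell pi A !=set0 -> coincide_on (cell pi A) f (g (theta_of A)).
  by move=> A0 x /cell_sub_piece Ax; apply: hg => //; exact: chamber_cell.
have dg A : cell pi A !=set0 -> (deg (g (theta_of A)) <= d)%N.
  move=> /(chamber_cell pi1) /asboolP cA; rewrite hd.
  exact: (@leq_bigmax_cond _ _ (fun theta => deg (g theta))).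
have [v v0] := generic_direction pi1.
have [p' Ep] : exists p', #|nonempty_cells pi| = p'.+1.
  have [s hs] := filter_ex (near_generic pi1 0 v0).
  have : (0 < #|nonempty_cells pi|)%N.
    apply/card_gt0P; exists (sign_set pi (0 + s *: v)).
    by rewrite nonempty_cellsP; apply/asboolP; eexists; exact: hs.
  by case: #|_| => // k _; exists k.
pose c (i : 'I_p'.+1) := enum_val (cast_ord (esym Ep) i).
have c0 i : cell pi (c i) !=set0.
  by apply/asboolP; rewrite -nonempty_cellsP; exact: enum_valP.
have cP A : cell pi A !=set0 -> exists i, c i = A.
  move=> A0; have AK : A \in nonempty_cells pi.
    by rewrite nonempty_cellsP; apply/asboolP.
  exists (cast_ord Ep (enum_rank_in AK A)).
  by rewrite /c cast_ordK enum_rankK_in.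
have sep k i := separating_poly pi1 cf (c0 i) (c0 k) (gcell _ (c0 i))
  (gcell _ (c0 k)) (dg _ (c0 i)) (dg _ (c0 k)).
pose F k i := projT1 (cid (sep k i)).
have FP k i : [/\ (deg (F k i) <= 2 * d + 1)%N,
    (forall x, cell pi (c i) x -> peval (F k i) x <= f x) &
    (forall x, cell pi (c k) x -> f x <= peval (F k i) x)].
  exact: projT2 (cid (sep k i)).
exists p', F; split=> [x|k i|]; first last.
- by rewrite -Ep card_nonempty_cells.
- by case: (FP k i).
pose G y := fin_max (fun i => fin_min (fun j => peval (F i j) y)).
apply: (@eq_of_ray _ _ f G x v cf).
  exact/max_definable_continuous/max_definable_max_min.
apply: filterS (near_generic pi1 x v0) => s.
(* At a point y of the cell c i, the i-th minimum is f y and no other minimum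
   is larger, since each of them contains F k i y <= f y. *)
set y := x + s *: v => Ay; have [i ci] := cP _ (ex_intro _ y Ay).
rewrite -ci in Ay.
apply/esym/(@fin_max_eq _ _ _ _ i) => [k|].
  by apply: le_trans (fin_min_le _ i) _; case: (FP k i) => _ /(_ y Ay).
apply: le_anti; apply/andP; split.
  by apply: le_trans (fin_min_le _ i) _; case: (FP i i) => _ /(_ y Ay).
by apply: fin_min_ge => k; case: (FP i k) => _ _ /(_ y Ay).
Qed.
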